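(* For a prime $p$, let $\mathcal{W}_p$ be the set of elliptic curves $E$ over $\mathbb{Q}$ such that $p^2$ divides the discriminant of $E$. For any $Q\ge 5$ and $\epsilon>0$, $$\#\bigcup_{p>Q}\{E_{A,B}\in\mathcal{W}_p: h(E_{A,B})<X\}=O_\epsilon\!\left(\frac{X^{2+\epsilon}}{Q}+X^{7/4+\epsilon}\right),$$ where the union is over primes $p>Q$.
   Context: Every elliptic curve $E$ over $\mathbb{Q}$ is uniquely expressed (up to isomorphism) as $E_{A,B}: y^2=x^3+Ax+B$ with $A,B\in\mathbb{Z}$, nonzero discriminant $-16(4A^3+27B^2)$, and such that for all primes $p$, if $p^4\mid A$ then $p^6\nmid B$. The height is $h(E_{A,B}):=\max\{|A|,|B|\}$. The implied constant depends only on $\epsilon$. *)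

(* Defs.v *)
From HB Require Import structures.
From mathcomp Require Import all_boot all_order all_algebra finmap.
From mathcomp Require Import all_classical all_reals all_analysis.
Set Implicit Arguments.
Unset Strict Implicit.
Unset Printing Implicit Defensive.
Import Order.TTheory GRing.Theory Num.Theory.
Local Open Scope classical_set_scope.
Local Open Scope ring_scope.

(* A pair E = (A, B) stands for the curve E_{A,B} : y^2 = x^3 + A x + B. *)
Definition disc (E : int * int) : int :=
  - 16 * (4 * E.1 ^+ 3 + 27 * E.2 ^+ 2).

(* The elliptic curves over Q up to isomorphism: each class has exactly one
   representative E_{A,B} in this set. *)
Definition ellcurves : set (int * int) :=
  [set E | disc E != 0 /\
    forall p : nat, prime p ->
      (p%:Z ^+ 4 %| E.1)%Z -> ~~ (p%:Z ^+ 6 %| E.2)%Z].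

Definition height (E : int * int) : int := Num.max `|E.1| `|E.2|.

Definition W (p : nat) : set (int * int) :=
  [set E | ellcurves E /\ (p%:Z ^+ 2 %| disc E)%Z].

Definition W_union (R : realType) (Q X : R) : set (int * int) :=
  \bigcup_(p in [set p : nat | prime p /\ Q < p%:R])
    [set E | W p E /\ (height E)%:~R < X].

(* Main.v *)
(** If p is coprime to A and p^2 divides 4 A^3 + 27 B^2, then a double root r
    modulo p^2 turns the index form of Z[x]/(x^3 + A x - B) into the integral
    binary cubic form
      p x^3 + 3 r x^2 y + ((3 r^2 + A) / p) x y^2 + ((r^3 + A r - B) / p^2) y^3,
    which represents p at a primitive vector and whose Hessian and Jacobian
    covariants there give back A and B.  Gauss reduction of the positive form
    (p x + r y)^2 + N y^2 (N the height bound) replaces this cubic by an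
    equivalent one with coefficients a, b, c, d, representing p at (l, -n), where
    |a d n l| << N and |b c| << N^(3/2) / p.  For p > N^(3/4) there are at most
    O(N^(7/4 + eps)) such tuples.  The condition a d <> 0 fails only when
    x^3 + A x - B has an integer root, which is rare.  Primes below N^(3/4), and
    primes dividing both A and B, are handled by counting residues modulo p^2,
    respectively modulo p. *)
Require Import Defs.
From HB Require Import structures.
From mathcomp Require Import all_boot all_order all_algebra finmap.
From mathcomp Require Import all_classical all_reals all_analysis.
From mathcomp Require Import ring lra zify.
Set Implicit Arguments.
Unset Strict Implicit.
Unset Printing Implicit Defensive.
Import Order.TTheory GRing.Theory Num.Theory.
Local Open Scope classical_set_scope.
Local Open Scope ring_scope.

(** * Divisibility by [p] and by [p^2] *)

Lemma coprimez_prime (p : nat) (z : int) :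
  prime p -> ~~ (p%:Z %| z)%Z -> coprimez p%:Z z.
Proof. by move=> pp; rewrite coprimezE prime_coprime. Qed.

Lemma coprimez_prime_lt (p d : nat) :
  prime p -> (0 < d < p)%N -> coprimez p%:Z d%:Z.
Proof.
move=> pp /andP[d0 dp]; apply: coprimez_prime => //.
by apply/negP => /(dvdn_leq d0); rewrite leqNgt dp.
Qed.

Lemma dvdz_disc (p : nat) (A B : int) : prime p -> (2 < p)%N ->
  (p%:Z ^+ 2 %| disc (A, B))%Z -> (p%:Z ^+ 2 %| 4 * A ^+ 3 + 27 * B ^+ 2)%Z.
Proof.
move=> pp p2; have c2 : coprimez p%:Z 2 by exact: (@coprimez_prime_lt p 2).
rewrite /disc mulNr rpredN /= Gauss_dvdzr //.
by rewrite (_ : 16 = 2 ^+ 4) // coprimezXl // coprimezXr.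
Qed.

(** Both [4] and [27] are units modulo [p > 3], so [p] divides [A^3] exactly when it divides [B^2].
    Each prime thus divides both coefficients or neither. *)
Lemma dvdz_coefs (p : nat) (A B : int) : prime p -> (3 < p)%N ->
  (p%:Z ^+ 2 %| 4 * A ^+ 3 + 27 * B ^+ 2)%Z -> (p%:Z %| A)%Z = (p%:Z %| B)%Z.
Proof.
move=> pp p3 h.
have c2 : coprimez p%:Z 2 by apply: (@coprimez_prime_lt p 2) => //; exact: ltn_trans p3.
have c3 : coprimez p%:Z 3 by exact: (@coprimez_prime_lt p 3).
have {}h : (p%:Z %| 4 * A ^+ 3 + 27 * B ^+ 2)%Z.
  by rewrite (dvdz_trans _ h) // expr2 dvdz_mulr.
have : (p%:Z %| 4 * A ^+ 3)%Z = (p%:Z %| 27 * B ^+ 2)%Z.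
  apply/idP/idP => hp.
    by rewrite -(addKr (4 * A ^+ 3) (27 * B ^+ 2)) rpredD ?rpredN.
  by rewrite -(addrK (27 * B ^+ 2) (4 * A ^+ 3)) rpredB.
rewrite Gauss_dvdzr; last by rewrite (_ : 4 = 2 ^+ 2) // coprimezXr.
rewrite Gauss_dvdzr; last by rewrite (_ : 27 = 3 ^+ 3) // coprimezXr.
by rewrite !dvdzE !abszX !Euclid_dvdX // !andbT.
Qed.

(** * Gauss reduction of binary quadratic forms *)

(** Here [- j] is [b / e] rounded to a nearest integer; the inequality is doubled to avoid
    halves. *)
Lemma balanced_residue (e b : int) : 0 < e ->
  exists j : int, - e <= 2 * (b + j * e) <= e.
Proof.
move=> e0; exists (- ((2 * b + e) %/ (2 * e))%Z).
have e20 : 2 * e != 0 by lia.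
have := divz_eq (2 * b + e) (2 * e); have := modz_ge0 (2 * b + e) e20.
have := @ltz_pmod (2 * b + e) (2 * e) ltac:(lia).
set q := (_ %/ _)%Z; set t := (_ %% _)%Z => t1 t0 tE.
have -> : 2 * (b + - q * e) = 2 * b + e - q * (2 * e) - e by ring.
by rewrite tE; lra.
Qed.

(** The squared length of [(p m + r n, sqrt N n)], a vector of a plane lattice of covolume
    [p sqrt N]. *)
Definition bqf (p r N m n : int) : int := (p * m + r * n) ^+ 2 + N * n ^+ 2.

Lemma bqf_lagrange (p r N m n k l : int) :
  bqf p r N m n * bqf p r N k l =
  ((p * m + r * n) * (p * k + r * l) + N * n * l) ^+ 2
  + N * p ^+ 2 * (m * l - n * k) ^+ 2.
Proof. rewrite /bqf; ring. Qed.

(** Descent on the length of the first basis vector: the second one is shifted to be nearly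
    orthogonal to it, and the two are exchanged if it is then shorter. At the end the inner product
    is at most half the first squared length, so Lagrange's identity bounds the product of squared
    lengths by [4/3] of the squared covolume, rounded up to [2]. *)
Lemma reduced_basis (p r N : int) : 0 < p -> 0 < N ->
  exists m n k l : int, m * l - n * k = 1 /\
    bqf p r N m n * bqf p r N k l <= 2 * (N * p ^+ 2).
Proof.
move=> p0 N0.
pose T := bqf p r N.
have Tge0 m n : 0 <= T m n.
  by rewrite /T /bqf addr_ge0 ?sqr_ge0 // mulr_ge0 ?sqr_ge0 // ltW.
suff H e : forall m n k l : int, m * l - n * k = 1 -> (`|T m n| < e)%N ->
    exists m n k l : int, m * l - n * k = 1 /\ T m n * T k l <= 2 * (N * p ^+ 2).
  exact: (H `|T 1 0|.+1 1 0 0 1).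
elim: e => [//|e IH] m n k l D le.
have D0 : 0 < N * p ^+ 2 by rewrite mulr_gt0 ?exprn_gt0.
have E0 : 0 < T m n.
  have := bqf_lagrange p r N m n k l; rewrite D expr1n mulr1 -/T.
  rewrite lt_neqAle Tge0 andbT eq_sym; apply: contra_eq_neq => ->.
  by rewrite mul0r lt_eqF // ltr_wpDl ?sqr_ge0.
have [j /andP[j1 j2]] := balanced_residue ((p * m + r * n) * (p * k + r * l) + N * n * l) E0.
have D' : m * (l + j * n) - n * (k + j * m) = 1 by rewrite -D; ring.
have := bqf_lagrange p r N m n (k + j * m) (l + j * n); rewrite D' expr1n mulr1 -/T.
have -> : (p * m + r * n) * (p * (k + j * m) + r * (l + j * n)) + N * n * (l + j * n)
  = (p * m + r * n) * (p * k + r * l) + N * n * l + j * T m n.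
  by rewrite /T /bqf; ring.
move: j1 j2; set b := _ + j * T m n => j1 j2 L.
have [G|G] := leP (T m n) (T (k + j * m) (l + j * n)).
  exists m, n, (k + j * m), (l + j * n); split => //.
  have b2 : 4 * b ^+ 2 <= T m n ^+ 2.
    rewrite -subr_ge0 (_ : _ - _ = (T m n - 2 * b) * (T m n + 2 * b)); last by ring.
    by apply: mulr_ge0; lra.
  have : T m n ^+ 2 <= T m n * T (k + j * m) (l + j * n) by rewrite expr2 ler_pM2l.
  by lia.
(* The sign on the old first vector keeps the determinant equal to [1]. *)
apply: (IH (k + j * m) (l + j * n) (- m) (- n)); first by rewrite -D'; ring.
have := Tge0 (k + j * m) (l + j * n); lia.
Qed.

(** * Double roots modulo [p^2] and integer roots *)

(* The double root of x^3 + A x - B is 3 B / (2 A). *)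
Lemma double_root (p : nat) (A B : int) : prime p -> (2 < p)%N ->
  ~~ (p%:Z %| A)%Z -> (p%:Z ^+ 2 %| 4 * A ^+ 3 + 27 * B ^+ 2)%Z ->
  exists r : int, (p%:Z ^+ 2 %| 3 * r ^+ 2 + A)%Z /\
                  (p%:Z ^+ 2 %| r ^+ 3 + A * r - B)%Z.
Proof.
move=> pp p2 pA /dvdzP[t tE].
have c2A : coprimez (p%:Z ^+ 2) (2 * A).
  by rewrite coprimezXl // coprimezMr (@coprimez_prime_lt p 2) // coprimez_prime.
have [[u v] /= uv] := coprimezP _ _ c2A.
pose P := p%:Z ^+ 2; rewrite -/P in tE c2A uv *.
clearbody P.
have kE : v * (2 * A) = 1 - u * P by apply/eqP; rewrite eq_sym subr_eq addrC uv.
exists (v * (3 * B)); split.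
  (* Multiplying by the unit [4 A^2] clears the inverse [v] of [2 A], and expanding [(1 - u P)^2]
     gives the quotient. The second divisibility uses [8 A^3] and [(1 - u P)^3] in the same way. *)
  have h : coprimez P (4 * A ^+ 2).
    by rewrite (_ : 4 * A ^+ 2 = (2 * A) ^+ 2); [rewrite coprimezXr|ring].
  rewrite -(Gauss_dvdzr _ h); apply/dvdzP.
  exists (t + 27 * B ^+ 2 * (u ^+ 2 * P - 2 * u)).
  have -> : 4 * A ^+ 2 * (3 * (v * (3 * B)) ^+ 2 + A) =
     27 * B ^+ 2 * (v * (2 * A)) ^+ 2 + 4 * A ^+ 3 by ring.
  apply/eqP; rewrite kE -subr_eq0; apply/eqP.
  by transitivity (4 * A ^+ 3 + 27 * B ^+ 2 - t * P); [ring | rewrite tE subrr].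
have h : coprimez P (8 * A ^+ 3).
  by rewrite (_ : 8 * A ^+ 3 = (2 * A) ^+ 3); [rewrite coprimezXr|ring].
rewrite -(Gauss_dvdzr _ h); apply/dvdzP.
exists (B * t + 27 * B ^+ 3 * (- 3 * u + 3 * u ^+ 2 * P - u ^+ 3 * P ^+ 2) - 12 * A ^+ 3 * B * u).
have -> : 8 * A ^+ 3 * ((v * (3 * B)) ^+ 3 + A * (v * (3 * B)) - B) =
     27 * B ^+ 3 * (v * (2 * A)) ^+ 3 + 12 * A ^+ 3 * B * (v * (2 * A)) - 8 * A ^+ 3 * B by ring.
apply/eqP; rewrite kE -subr_eq0; apply/eqP.
by transitivity (B * (4 * A ^+ 3 + 27 * B ^+ 2 - t * P)); [ring | rewrite tE subrr mulr0].
Qed.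

(** The rational root theorem in homogeneous form: after division by the gcd, the denominator
    divides a cube coprime to it, hence is a unit. *)
Lemma no_rational_root (A B : int) : (forall s : int, s ^+ 3 + A * s != B) ->
  forall x y : int, (x != 0) || (y != 0) ->
  x ^+ 3 + A * x * y ^+ 2 - B * y ^+ 3 != 0.
Proof.
move=> root x y xy; have [y0|y0] := eqVneq y 0.
  by move: xy; rewrite y0 eqxx orbF !expr0n /= !mulr0 subr0 addr0 expf_eq0.
apply/negP => /eqP E.
set g := gcdz x y.
have g0 : g != 0 by rewrite /g gcdz_eq0 (negbTE y0) andbF.
have [[x' xE] [y' yE]] := (dvdzP (dvdz_gcdl x y), dvdzP (dvdz_gcdr x y)).
rewrite -/g in xE yE.
have cop : coprimez y' x'.
  have := mulz_gcdl x' y' g; rewrite -xE -yE -/g -/g => h.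
  have gE : `|g|%:Z = g by rewrite /g.
  by rewrite gE in h; rewrite coprimez_sym; apply/eqP; apply: (mulIf g0); rewrite h mul1r.
have E' : x' ^+ 3 + A * x' * y' ^+ 2 - B * y' ^+ 3 = 0.
  apply: (mulIf (expf_neq0 3 g0)); rewrite mul0r -E xE yE; ring.
have : (y' %| x' ^+ 3 * 1)%Z.
  apply/dvdzP; exists (B * y' ^+ 2 - A * x' * y'); apply/eqP.
  rewrite -subr_eq0; apply/eqP; rewrite -E'; ring.
rewrite Gauss_dvdzr ?coprimezXr // dvdz1 => /eqP y1.
have yy : y' * y' = 1 by rewrite -expr2 -real_normK ?num_real -?abszE ?y1.
(* The unit [y'] is its own inverse, so [x' * y'] is the quotient of [x'] by [y']. *)
have := root (x' * y'); apply/negP/negPn.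
rewrite -subr_eq0; apply/eqP; transitivity (y' * (x' ^+ 3 + A * x' * y' ^+ 2 - B * y' ^+ 3)
  + (y' * y' - 1) * (x' ^+ 3 * y' - A * x' * y' + B * (y' * y' + 1))); first by ring.
by rewrite E' yy subrr mulr0 mul0r addr0.
Qed.

(** * Binary cubic forms and their covariants *)

(** The Hessian is scaled so that the cubic attached to [p] has Hessian leading coefficient
    [- 3 A]. *)
Definition hess0 (a b c d : int) : int := b ^+ 2 - 3 * a * c.
Definition hess1 (a b c d : int) : int := b * c - 9 * a * d.
Definition hess2 (a b c d : int) : int := c ^+ 2 - 3 * b * d.

Definition qform (P Q S x y : int) : int := P * x ^+ 2 + Q * x * y + S * y ^+ 2.

(* Jacobian determinant of the cubic (a, b, c, d) and the quadratic (P, Q, S);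
   the classical cubic covariant when (P, Q, S) is the Hessian. *)
Definition jac (a b c d P Q S x y : int) : int :=
  (3 * a * x ^+ 2 + 2 * b * x * y + c * y ^+ 2) * (Q * x + 2 * S * y)
  - (b * x ^+ 2 + 2 * c * x * y + 3 * d * y ^+ 2) * (2 * P * x + Q * y).

Section Subst.
Variables (a b c d m n k l : int).
Hypothesis D : m * l - n * k = 1.
(** [subst_a] to [subst_d] are the coefficients of the cubic after
    [(x, y) -> (m x + k y, n x + l y)]. *)
Definition subst_a := a * m ^+ 3 + b * m ^+ 2 * n + c * m * n ^+ 2 + d * n ^+ 3.
Definition subst_b := 3 * a * m ^+ 2 * k + b * (m ^+ 2 * l + 2 * m * n * k)
   + c * (n ^+ 2 * k + 2 * m * n * l) + 3 * d * n ^+ 2 * l.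
Definition subst_c := 3 * a * m * k ^+ 2 + b * (k ^+ 2 * n + 2 * k * l * m)
   + c * (l ^+ 2 * m + 2 * k * l * n) + 3 * d * n * l ^+ 2.
Definition subst_d := a * k ^+ 3 + b * k ^+ 2 * l + c * k * l ^+ 2 + d * l ^+ 3.

Local Notation P := (hess0 a b c d).
Local Notation Q := (hess1 a b c d).
Local Notation S := (hess2 a b c d).

(** Covariance in general carries a power of the determinant [m l - n k]. Here and below that power
    of [1] is inserted first, which leaves a polynomial identity. *)
Lemma hess0_subst :
  hess0 subst_a subst_b subst_c subst_d = qform P Q S m n.
Proof.
transitivity ((m * l - n * k) ^+ 2 * qform P Q S m n); last by rewrite D expr1n mul1r.
rewrite /qform /hess0 /hess1 /hess2 /subst_a /subst_b /subst_c /subst_d.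
ring.
Qed.

Lemma hess1_subst :
  hess1 subst_a subst_b subst_c subst_d =
  2 * P * m * k + Q * (m * l + n * k) + 2 * S * n * l.
Proof.
transitivity ((m * l - n * k) ^+ 2 * (2 * P * m * k + Q * (m * l + n * k) + 2 * S * n * l));
  last by rewrite D expr1n mul1r.
rewrite /qform /hess0 /hess1 /hess2 /subst_a /subst_b /subst_c /subst_d.
ring.
Qed.

Lemma hess2_subst :
  hess2 subst_a subst_b subst_c subst_d = qform P Q S k l.
Proof.
transitivity ((m * l - n * k) ^+ 2 * qform P Q S k l); last by rewrite D expr1n mul1r.
rewrite /qform /hess0 /hess1 /hess2 /subst_a /subst_b /subst_c /subst_d.
ring.
Qed.

(** The substitution sends [(l, - n)] to [(1, 0)], so evaluating there recovers the leading
    coefficient of the original form. *)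
Lemma qform_subst (p q s : int) :
  qform (qform p q s m n) (2 * p * m * k + q * (m * l + n * k) + 2 * s * n * l)
    (qform p q s k l) l (- n) = p.
Proof.
transitivity ((m * l - n * k) ^+ 2 * p); last by rewrite D expr1n mul1r.
rewrite /qform.
ring.
Qed.

(** The same evaluation for the Jacobian; on the cubic attached to [p] and its Hessian the
    right-hand side is [27 B]. *)
Lemma jac_subst (p q s : int) :
  jac subst_a subst_b subst_c subst_d
    (qform p q s m n) (2 * p * m * k + q * (m * l + n * k) + 2 * s * n * l)
    (qform p q s k l) l (- n) = 3 * a * q - 2 * b * p.
Proof.
transitivity ((m * l - n * k) ^+ 4 * (3 * a * q - 2 * b * p)); last by rewrite D expr1n mul1r.
rewrite /jac /qform /subst_a /subst_b /subst_c /subst_d.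
ring.
Qed.
End Subst.

(** * Size of the coefficients of the reduced cubic *)

Section Polar.
Variable R : realFieldType.

(** The expression is three times the polarization of [x^3 + al x y^2 - be y^3]; its nine unit terms
    give the [9]. Evaluated at basis vectors it yields the coefficients of the reduced cubic. *)
Lemma polar_bound (al be x1 y1 s1 x2 y2 s2 x3 y3 s3 : R) :
  `|al| <= 1 -> `|be| <= 1 -> `|x1| <= s1 -> `|y1| <= s1 ->
  `|x2| <= s2 -> `|y2| <= s2 -> `|x3| <= s3 -> `|y3| <= s3 ->
  `|3 * x1 * x2 * x3 + al * (x1 * y2 * y3 + y1 * x2 * y3 + y1 * y2 * x3)
    - 3 * be * y1 * y2 * y3| <= 9 * (s1 * s2 * s3).
Proof.
move=> hal hbe h1 h1' h2 h2' h3 h3'.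
have M (u v w : R) : `|u| <= s1 -> `|v| <= s2 -> `|w| <= s3 -> `|u * v * w| <= s1 * s2 * s3.
  by move=> ? ? ?; rewrite !normrM !ler_pM // mulr_ge0.
have M' (z t : R) : `|z| <= 1 -> `|z * t| <= `|t|.
  by move=> ?; rewrite normrM ler_piMl.
have -> : 3 * x1 * x2 * x3 + al * (x1 * y2 * y3 + y1 * x2 * y3 + y1 * y2 * x3)
    - 3 * be * y1 * y2 * y3 = 3 * (x1 * x2 * x3) + al * (x1 * y2 * y3)
    + al * (y1 * x2 * y3) + al * (y1 * y2 * x3) - 3 * (be * (y1 * y2 * y3)) by ring.
have K z t : `|z| <= 1 -> `|t| <= s1 * s2 * s3 -> `|z * t| <= s1 * s2 * s3.
  by move=> hz; apply: le_trans; apply: M'.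
have /ler_normlP[a1 a2] := M _ _ _ h1 h2 h3.
have /ler_normlP[b1 b2] := K _ _ hal (M _ _ _ h1 h2' h3').
have /ler_normlP[c1 c2] := K _ _ hal (M _ _ _ h1' h2 h3').
have /ler_normlP[d1 d2] := K _ _ hal (M _ _ _ h1' h2' h3).
have /ler_normlP[e1 e2] := K _ _ hbe (M _ _ _ h1' h2' h3').
by apply/ler_normlP; split; lra.
Qed.

End Polar.

Section Bounds.
Variable R : realFieldType.

(** Each product bounded here carries equal powers of [s] and [w], the lengths of the two reduced
    vectors, so only [s w <= 2 p q] matters. The cube [52^3 = 140608] rounds up
    [3 * 9^3 * 2^6 = 139968], so that a cube root can be taken later. *)
Lemma coef_bounds (p q s w a b c d n l : R) :
  0 < p -> 0 < q -> 0 <= s -> 0 <= w -> s * w <= 2 * p * q ->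
  0 <= a -> 0 <= b -> 0 <= c -> 0 <= d -> 0 <= n -> 0 <= l ->
  p ^+ 2 * a <= 3 * s ^+ 3 -> p ^+ 2 * b <= 9 * (s ^+ 2 * w) ->
  p ^+ 2 * c <= 9 * (s * w ^+ 2) -> p ^+ 2 * d <= 3 * w ^+ 3 ->
  q * n <= s -> q * l <= w ->
  [/\ p * (a * d) <= 72 * q ^+ 3, a * d * (n * l) <= 144 * q ^+ 2,
      p * (b * c) <= 648 * q ^+ 3, p ^+ 2 * (a * c ^+ 3) <= 52 ^+ 3 * q ^+ 6 &
      p ^+ 2 * (d * b ^+ 3) <= 52 ^+ 3 * q ^+ 6].
Proof.
move=> p0 q0 s0 w0 sw a0 b0 c0 d0 n0 l0 ha hb hc hd hn hl.
have p0' := ltW p0; have q0' := ltW q0.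
have sw0 : 0 <= s * w by rewrite mulr_ge0.
have Z e : (s * w) ^+ e <= (2 * p * q) ^+ e.
  by rewrite lerXn2r // nnegrE !mulr_ge0.
have M (x y u v : R) : 0 <= x -> 0 <= u -> x <= y -> u <= v -> x * u <= y * v.
  by move=> *; rewrite ler_pM.
have pp e (x : R) : 0 <= x -> 0 <= p ^+ e * x by move=> ?; rewrite mulr_ge0 ?exprn_ge0.
have qq (x : R) : 0 <= x -> 0 <= q * x by move=> ?; rewrite mulr_ge0.
have X3 (x y : R) : 0 <= x -> x <= y -> x ^+ 3 <= y ^+ 3.
  by move=> ? ?; rewrite lerXn2r // nnegrE // (le_trans _ (_ : x <= y)).
have cancel e (x y : R) : p ^+ e * x <= p ^+ e * y -> x <= y by rewrite ler_pM2l ?exprn_gt0.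
have had := M _ _ _ _ (pp _ _ a0) (pp _ _ d0) ha hd.
split.
- apply: (cancel 3%N); have := Z 3%N; lra.
- apply: (cancel 4%N); have qn := M _ _ _ _ (qq _ n0) (qq _ l0) hn hl.
  have := M _ _ _ _ (mulr_ge0 (pp _ _ a0) (pp _ _ d0)) (mulr_ge0 (qq _ n0) (qq _ l0)) had qn.
  have := Z 4%N => z1 z2.
  rewrite -(ler_pM2l (exprn_gt0 2 q0)); lra.
- apply: (cancel 3%N); have := M _ _ _ _ (pp _ _ b0) (pp _ _ c0) hb hc; have := Z 3%N; lra.
- apply: (cancel 6%N).
  have := M _ _ _ _ (pp _ _ a0) (exprn_ge0 3 (pp _ _ c0)) ha (X3 _ _ (pp _ _ c0) hc).
  have := Z 6%N; have := pp 6%N _ (exprn_ge0 6 q0'); lra.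
apply: (cancel 6%N).
have := M _ _ _ _ (pp _ _ d0) (exprn_ge0 3 (pp _ _ b0)) hd (X3 _ _ (pp _ _ b0) hb).
have := Z 6%N; have := pp 6%N _ (exprn_ge0 6 q0'); lra.
Qed.
End Bounds.

(** The tuple alone determines [A] and [B], so counting tuples counts curves. The entries [a] and
    [d] are values of the cubic at primitive vectors, nonzero because no integer root exists. The
    last two bounds control [c] or [b] when the other one vanishes. *)
Lemma reduced_cubic_form (R : rcfType) (N p : nat) (A B : int) :
  prime p -> (2 < p)%N -> (0 < N)%N -> `|A| <= N%:Z -> `|B| <= N%:Z ->
  ~~ (p%:Z %| A)%Z -> (p%:Z ^+ 2 %| 4 * A ^+ 3 + 27 * B ^+ 2)%Z ->
  (forall s : int, s ^+ 3 + A * s != B) ->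
  exists a b c d n l : int,
  let P := hess0 a b c d in let Q := hess1 a b c d in let S := hess2 a b c d in
  [/\ qform P Q S l (- n) = - 3 * A /\ jac a b c d P Q S l (- n) = 27 * B,
    a != 0 /\ d != 0, exists m k, m * l - n * k = 1 &
    forall q : R, 0 < q -> q ^+ 2 = N%:R ->
    let I (z : int) : R := z%:~R in
    [/\ p%:R * (`|I a| * `|I d|) <= 72 * q ^+ 3,
        `|I a| * `|I d| * (`|I n| * `|I l|) <= 144 * q ^+ 2,
        p%:R * (`|I b| * `|I c|) <= 648 * q ^+ 3,
        p%:R ^+ 2 * (`|I a| * `|I c| ^+ 3) <= 52 ^+ 3 * q ^+ 6 &
        p%:R ^+ 2 * (`|I d| * `|I b| ^+ 3) <= 52 ^+ 3 * q ^+ 6]].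
Proof.
move=> pp p2 N0 hA hB pA pD root.
have [r [/dvdzP[t tE] /dvdzP[b0 b0E]]] := double_root pp p2 pA pD.
have pz : 0 < p%:Z :> int by rewrite ltz_nat prime_gt0.
have [m [n [k [l [D T]]]]] := @reduced_basis p%:Z r N%:Z pz N0.
have AE : A = t * p%:Z ^+ 2 - 3 * r ^+ 2 by rewrite -tE addrC addKr.
have BE : B = r ^+ 3 + A * r - b0 * p%:Z ^+ 2 by rewrite -b0E; ring.
(* The cubic attached to [p] has coefficients [p], [3 r], [(3 r^2 + A) / p = t p] and
   [b0 = (r^3 + A r - B) / p^2]. *)
pose b1 := 3 * r; pose c1 := t * p%:Z.
pose a := subst_a p%:Z b1 c1 b0 m n; pose b := subst_b p%:Z b1 c1 b0 m n k l.
pose c := subst_c p%:Z b1 c1 b0 m n k l; pose d := subst_d p%:Z b1 c1 b0 k l.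
exists a, b, c, d, n, l.
move=> P Q S.
have key (x y : int) : p%:Z ^+ 2 * (p%:Z * x ^+ 3 + 3 * r * x ^+ 2 * y + t * p%:Z * x * y ^+ 2
    + b0 * y ^+ 3) = (p%:Z * x + r * y) ^+ 3 + A * (p%:Z * x + r * y) * y ^+ 2 - B * y ^+ 3.
  by rewrite BE AE; ring.
have nz (x y : int) : (x != 0) || (y != 0) ->
  p%:Z * x ^+ 3 + 3 * r * x ^+ 2 * y + t * p%:Z * x * y ^+ 2 + b0 * y ^+ 3 != 0.
  move=> xy; suff : p%:Z ^+ 2 * (p%:Z * x ^+ 3 + 3 * r * x ^+ 2 * y + t * p%:Z * x * y ^+ 2
      + b0 * y ^+ 3) != 0.
    by rewrite mulf_eq0 negb_or => /andP[].
  rewrite key; apply: no_rational_root => //.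
  have [y0|y0] := eqVneq y 0; last by rewrite orbT.
  move: xy; rewrite y0 eqxx /= !orbF mulr0 addr0 mulf_eq0. by rewrite (gt_eqF pz).
split.
- rewrite /P /Q /S /a /b /c /d hess0_subst // hess1_subst // hess2_subst // qform_subst // jac_subst //.
  by rewrite /hess0 /hess1 /b1 /c1 BE AE; split; ring.
- split; apply: nz; apply: contra_eqT D; rewrite negb_or !negbK => /andP[/eqP-> /eqP->];
  by rewrite ?mul0r ?mulr0 subrr.
- by exists m, k.
move=> q q0 qN I.
pose x1 : int := p%:Z * m + r * n; pose x2 : int := p%:Z * k + r * l.
pose s := Num.sqrt (I (bqf p%:Z r N%:Z m n)); pose w := Num.sqrt (I (bqf p%:Z r N%:Z k l)).
have bE (u v : int) : I (bqf p%:Z r N%:Z u v) = (I (p%:Z * u + r * v)) ^+ 2 + (q * I v) ^+ 2.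
  by rewrite /I /bqf rmorphD rmorphM !rmorphXn exprMn qN.
have bd (u v : int) : `|I (p%:Z * u + r * v)| <= Num.sqrt (I (bqf p%:Z r N%:Z u v)) /\
     `|q * I v| <= Num.sqrt (I (bqf p%:Z r N%:Z u v)).
  by rewrite bE -!sqrtr_sqr; split; rewrite ler_wsqrtr // ?lerDl ?lerDr sqr_ge0.
have [s1 s2] := bd m n; have [w1 w2] := bd k l.
rewrite -/s -/w -/x1 -/x2 in s1 s2 w1 w2.
have N1 : 1 <= N%:R :> R by rewrite ler1n.
have q1 : 1 <= q by rewrite -(@expr_ge1 _ 2) // ?qN // ltW.
(* [|A| <= q^2] since [q^2 = N], and [|B| <= q^2 <= q^3] since [q >= 1]. *)
pose al := I A / q ^+ 2; pose be := I B / q ^+ 3.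
have hal : `|al| <= 1.
  rewrite /al normrM normfV (gtr0_norm (exprn_gt0 _ q0)) ler_pdivrMr ?exprn_gt0 // mul1r qN.
  by rewrite /I -intr_norm -[N%:R]/(N%:Z%:~R) ler_int.
have hbe : `|be| <= 1.
  rewrite /be normrM normfV (gtr0_norm (exprn_gt0 _ q0)) ler_pdivrMr ?exprn_gt0 // mul1r.
  rewrite (@le_trans _ _ (q ^+ 2)) ?ler_weXn2l // qN.
  by rewrite /I -intr_norm -[N%:R]/(N%:Z%:~R) ler_int.
have sw : s * w <= 2 * p%:R * q.
  rewrite /s /w -sqrtrM ?bE ?addr_ge0 ?sqr_ge0 // -!bE.
  have -> : 2 * p%:R * q = Num.sqrt ((2 * p%:R * q) ^+ 2).
    by rewrite sqrtr_sqr ger0_norm // !mulr_ge0 // ltW.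
  rewrite ler_wsqrtr // /I -rmorphM /= !exprMn qN.
  have : (bqf p%:Z r N%:Z m n * bqf p%:Z r N%:Z k l)%:~R <= (2 * (N%:Z * p%:Z ^+ 2))%:~R :> R.
    by rewrite ler_int.
  rewrite [X in _ <= X]rmorphM rmorphM rmorphXn /= => /le_trans; apply.
  have -> : 2 ^+ 2 * p%:R ^+ 2 * N%:R = 2 * (2 * (N%:R * p%:R ^+ 2)) :> R by ring.
  rewrite [X in _ <= X]mulrC ler_peMr // ?mulr_ge0 ?exprn_ge0 //; lra.
have pb := polar_bound hal hbe.
(* In the coordinates [(x, q y)] the powers of [q] cancel against those in [al] and [be]. *)
have pE (u1 v1 u2 v2 u3 v3 : int) :
  3 * I u1 * I u2 * I u3 + al * (I u1 * (q * I v2) * (q * I v3)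
    + (q * I v1) * I u2 * (q * I v3) + (q * I v1) * (q * I v2) * I u3)
    - 3 * be * (q * I v1) * (q * I v2) * (q * I v3) =
  I (3 * u1 * u2 * u3 + A * (u1 * v2 * v3 + v1 * u2 * v3 + v1 * v2 * u3) - 3 * B * v1 * v2 * v3).
  rewrite /al /be /I !(rmorphD, rmorphB, rmorphM) /=; field; exact: lt0r_neq0.
have pI (z : int) : p%:R ^+ 2 * `|I z| = `|I (p%:Z ^+ 2 * z)|.
  by rewrite /I rmorphM rmorphXn normrM normrX normr_nat.
have qn (z : int) : q * `|I z| = `|q * I z| by rewrite normrM (gtr0_norm q0).
apply: (@coef_bounds R p%:R q s w) => //; rewrite ?qn ?sqrtr_ge0 ?ltr0n ?prime_gt0 //.
(* With three equal arguments the polar form is [3 p^2 a], whence the constant [3] instead of [9];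
   likewise for [d]. *)
- have := pb _ _ _ _ _ _ _ _ _ s1 s2 s1 s2 s1 s2; rewrite pE pI.
  rewrite (_ : _ - _ = 3 * (p%:Z ^+ 2 * a)); last first.
    by rewrite /a /x1 /subst_a /b1 /c1 BE AE; ring.
  rewrite /I [X in `|X|]rmorphM /= normrM normr_nat !exprS expr0 mulr1; lra.
- have := pb _ _ _ _ _ _ _ _ _ s1 s2 s1 s2 w1 w2; rewrite pE pI.
  rewrite (_ : _ - _ = (p%:Z ^+ 2 * b)) ?expr2 //.
  by rewrite /b /x1 /x2 /subst_b /b1 /c1 BE AE; ring.
- have := pb _ _ _ _ _ _ _ _ _ s1 s2 w1 w2 w1 w2; rewrite pE pI.
  rewrite (_ : _ - _ = (p%:Z ^+ 2 * c)) ?expr2 ?mulrA //.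
  by rewrite /c /x1 /x2 /subst_c /b1 /c1 BE AE; ring.
have := pb _ _ _ _ _ _ _ _ _ w1 w2 w1 w2 w1 w2; rewrite pE pI.
rewrite (_ : _ - _ = 3 * (p%:Z ^+ 2 * d)); last first.
  by rewrite /d /x2 /subst_d /b1 /c1 BE AE; ring.
rewrite /I [X in `|X|]rmorphM /= normrM normr_nat !exprS expr0 mulr1; lra.
Qed.

(** * Counting with finite lists and harmonic weights *)

Lemma card_cover (T : choiceType) (A : set T) (s : seq T) :
  A `<=` [set` s] -> finite_set A /\ (#|` fset_set A|%fset <= size s)%N.
Proof.
move=> As; have fA : finite_set A by apply: sub_finite_set As (finite_seq s).
split=> //; apply: (leq_trans _ (size_undup s)).
apply: uniq_leq_size => [|x]; first exact: fset_uniq.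
by rewrite mem_undup in_fset_set // inE => /As.
Qed.

Definition int_range (M : nat) : seq int :=
  [seq Posz i | i <- iota 0 M.+1] ++ [seq Negz i | i <- iota 0 M].

Lemma mem_int_range M (x : int) : (x \in int_range M) = (`|x| <= M)%N.
Proof.
rewrite mem_cat; case: x => n.
  rewrite mem_map; last by move=> ? ? [].
  rewrite mem_iota add0n ltnS; apply: orb_idr.
  by case/mapP.
rewrite orbC mem_map; last by move=> ? ? [].
rewrite mem_iota add0n /=; apply: orb_idr.
by case/mapP.
Qed.

Lemma size_int_range M : size (int_range M) = (2 * M).+1.
Proof. rewrite size_cat !size_map !size_iota; lia. Qed.

(* The maximum with 1 lets tuples with a zero entry obey the same product bounds. *)
Definition wt (k : int) : nat := maxn 1 `|k|.

Lemma wt_gt0 k : (0 < wt k)%N. Proof. by rewrite leq_max. Qed.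
Lemma wt_ge k : (`|k| <= wt k)%N. Proof. by rewrite leq_max leqnn orbT. Qed.

Section Sums.
Variable R : realType.

(** Rankin's trick: every counted [t] contributes at least [1] to the sum of [K / f t]. *)
Lemma size_filter_le (T : Type) (s : seq T) (f : T -> R) (K : R) :
  (forall t, 0 < f t) -> 0 <= K ->
  (size [seq t <- s | f t <= K])%:R <= K * \sum_(t <- s) (f t)^-1.
Proof.
move=> f0 K0; elim: s => [|t s IH] /=; first by rewrite big_nil mulr0.
rewrite big_cons mulrDr; case: ifP => [tK|_] /=.
  by rewrite -addn1 natrD addrC lerD // ler_pdivlMr // mul1r.
by rewrite (le_trans IH) // lerDr mulr_ge0 // invr_ge0 ltW.
Qed.

Definition wsum (M : nat) : R := \sum_(k <- int_range M) (wt k)%:R^-1.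

Lemma wsum_ge0 M : 0 <= wsum M. Proof. exact: sumr_ge0. Qed.

Lemma wsumE M : wsum M = \sum_(0 <= i < M.+1) (wt i%:Z)%:R^-1
   + \sum_(0 <= i < M) (wt (Negz i))%:R^-1.
Proof. by rewrite /wsum /int_range big_cat !big_map /index_iota !subn0. Qed.

Lemma wsumS M : wsum M.+1 = wsum M + 2 * M.+1%:R^-1.
Proof.
rewrite !wsumE (big_nat_recr M.+1) //= [X in _ + X = _](big_nat_recr M) //= addrACA.
by congr (_ + _); rewrite /wt /= !(maxn_idPr _) // mulr_natl. 
Qed.

Lemma wsum_le_ln M : wsum M.+1 <= 3 + 2 * ln (M.+1%:R : R).
Proof.
elim: M => [|M IH].
  by rewrite wsumS /wsum /int_range /= big_seq1 /= ln1 /wt /= !invr1; lra.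
rewrite wsumS; apply: (le_trans (lerD IH (lexx _))).
rewrite -addrA lerD2l -mulrDr ler_pM2l //.
have M0 : 0 < M.+1%:R :> R by [].
have M1 : 0 < M.+2%:R :> R by [].
(* [ln (1 + x) <= x] at [x = - 1 / (M + 2)] bounds the new term by the increment of the
   logarithm. *)
have : ln (1 + - (M.+2%:R^-1 : R)) <= - M.+2%:R^-1.
  by apply: le_ln1Dx; rewrite ltrN2 invf_lt1 // ltr1n.
have -> : 1 + - (M.+2%:R^-1 : R) = M.+1%:R / M.+2%:R.
  apply: (mulIf (lt0r_neq0 M1)); rewrite divfK ?lt0r_neq0 //.
  by rewrite mulrDl mul1r mulNr mulVf ?lt0r_neq0 // -[M.+2%:R](@natr1 _ M.+1) addrK.
by rewrite ln_div ?posrE // lerBlDr [X in _ <= X]addrC lerBrDr.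
Qed.

Lemma ln_le_powR (e x : R) : 0 < e -> 1 <= x -> ln x <= x `^ e / e.
Proof.
move=> e0 x1; rewrite ler_pdivlMr // mulrC -ln_powR.
by rewrite ltW // ln_sublinear // powR_gt0 // (lt_le_trans ltr01).
Qed.

(** The logarithm is absorbed into an arbitrarily small power, the source of [eps] in the final
    bound. *)
Lemma wsum_le (e : R) : 0 < e -> exists C : R, 0 < C /\
  forall M, (0 < M)%N -> wsum M <= C * M%:R `^ e.
Proof.
move=> e0; exists (3 + 2 / e); split; first by rewrite addr_gt0 ?divr_gt0.
case=> // M _; apply: le_trans (wsum_le_ln M) _.
have M1 : 1 <= M.+1%:R :> R by rewrite ler1n.
have := ln_le_powR e0 M1; have : 1 <= M.+1%:R `^ e :> R.
  by rewrite -[leLHS](powRr0 M.+1%:R) ler_powR // ltW.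
set P := _ `^ e => h1 h2; have -> : (3 + 2 / e) * P = 3 * P + 2 * (P / e) by ring.
by apply: lerD; [rewrite ler_peMr | rewrite ler_pM2l].
Qed.

Definition wt2 (u : int * int) : R := (wt u.1)%:R * (wt u.2)%:R.
Definition wt4 (u : (int * int) * (int * int)) : R := wt2 u.1 * wt2 u.2.

Lemma wt2_gt0 u : 0 < wt2 u. Proof. by rewrite mulr_gt0 // ltr0n wt_gt0. Qed.
Lemma wt4_gt0 u : 0 < wt4 u. Proof. by rewrite mulr_gt0 ?wt2_gt0. Qed.

Lemma sum_pairsM (T : Type) (s : seq T) (f : T -> R) :
  \sum_(u <- [seq (x, y) | x <- s, y <- s]) (f u.1 * f u.2)^-1 = (\sum_(x <- s) (f x)^-1) ^+ 2.
Proof.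
rewrite big_allpairs_dep expr2 big_distrlr /=.
by apply: eq_bigr => x _; apply: eq_bigr => y _; rewrite invfM.
Qed.

Definition range2 M := [seq (x, y) | x <- int_range M, y <- int_range M].
Definition range4 M := [seq (x, y) | x <- range2 M, y <- range2 M].

Lemma size_wt2 M (K : R) : 0 <= K ->
  (size [seq u <- range2 M | wt2 u <= K])%:R <= K * wsum M ^+ 2.
Proof.
move=> K0; have := size_filter_le (range2 M) wt2_gt0 K0.
by rewrite /wt2 (sum_pairsM _ (fun k => (wt k)%:R)).
Qed.

Lemma size_wt4 M (K : R) : 0 <= K ->
  (size [seq u <- range4 M | wt4 u <= K])%:R <= K * wsum M ^+ 4.
Proof.
move=> K0; have := size_filter_le (range4 M) wt4_gt0 K0.
rewrite /wt4 (sum_pairsM _ wt2) (sum_pairsM _ (fun k => (wt k)%:R)).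
by rewrite -exprM.
Qed.

Lemma sum_inv_sqr_tail (Q : R) (N : nat) : 0 < Q ->
  \sum_(n <- iota 1 N | Q < n%:R) (n%:R ^+ 2)^-1 <= 2 / Q :> R.
Proof.
move=> Q0.
(* The strengthened bound telescopes through [1 / (N + 1)^2 <= 1 / N - 1 / (N + 1)]; the [2] pays
   for the first term beyond [Q]. *)
suff : \sum_(n <- iota 1 N | Q < n%:R) (n%:R ^+ 2)^-1 <=
  if Q < N%:R then 2 / Q - N%:R^-1 else 0 :> R.
  move=> /le_trans; apply; case: ifP => _; last by rewrite divr_ge0 // ltW.
  by rewrite gerBl invr_ge0.
elim: N => [|N IH]; first by rewrite big_nil; case: ifP => //; rewrite ltNge ltW.
have -> : iota 1 N.+1 = iota 1 N ++ [:: N.+1] by rewrite -[N.+1]addn1 iotaD add1n addn1.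
rewrite big_cat big_cons big_nil /=.
have N1 : 0 < N.+1%:R :> R by [].
have NN : N.+1%:R = N%:R + 1 :> R by rewrite natr1.
move: IH; case: ifP => QN IH; last first.
  have S0 : \sum_(n <- iota 1 N | Q < n%:R) (n%:R ^+ 2)^-1 <= 0 :> R by [].
  case: ifP => QN1; last by rewrite addr0.
  rewrite addr0; apply: le_trans (lerD S0 (lexx _)) _; rewrite add0r.
  have h : N.+1%:R^-1 <= Q^-1 by rewrite lef_pV2 ?posrE // ltW.
  have h2 : (N.+1%:R ^+ 2)^-1 <= N.+1%:R^-1 :> R.
    by rewrite lef_pV2 ?posrE ?exprn_gt0 // ler_eXnr // ler1n.
  by move: (N.+1%:R ^+ 2)^-1 N.+1%:R^-1 Q^-1 h h2 => x y z; lra.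
have N0 : 0 < N%:R :> R by exact: lt_trans Q0 QN.
have -> : Q < N.+1%:R by rewrite (lt_trans QN) // ltr_nat.
rewrite addr0; apply: le_trans (lerD IH (lexx _)) _.
have : (N.+1%:R ^+ 2)^-1 <= N%:R^-1 - N.+1%:R^-1 :> R.
  have -> : N%:R^-1 - N.+1%:R^-1 = (N%:R * N.+1%:R)^-1 :> R.
    by rewrite NN; field; rewrite -NN !gt_eqF.
  by rewrite lef_pV2 ?posrE ?exprn_gt0 ?mulr_gt0 // expr2 ler_pM2r // ler_nat.
by move: (N.+1%:R ^+ 2)^-1 N.+1%:R^-1 N%:R^-1 => x y z; lra.
Qed.

End Sums.

(** * Finite covers, one for each case *)

(** [p^2] divides [(B - C) (B + C)], and [p] cannot divide both factors, since it would then divide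
    [2 B]. *)
Lemma sqr_congruence (p : nat) (A B C : int) : prime p -> (3 < p)%N ->
  ~~ (p%:Z %| A)%Z -> (p%:Z ^+ 2 %| 4 * A ^+ 3 + 27 * B ^+ 2)%Z ->
  (p%:Z ^+ 2 %| 4 * A ^+ 3 + 27 * C ^+ 2)%Z ->
  (p%:Z ^+ 2 %| B - C)%Z || (p%:Z ^+ 2 %| B + C)%Z.
Proof.
move=> pp p3 pA pB pC.
have p2 : coprimez p%:Z 2 by apply: (@coprimez_prime_lt p 2) => //; exact: ltn_trans p3.
have c3 : coprimez p%:Z 3 by exact: (@coprimez_prime_lt p 3).
have pB' : ~~ (p%:Z %| B)%Z by rewrite -(dvdz_coefs pp p3 pB).
have : (p%:Z ^+ 2 %| 27 * ((B - C) * (B + C)))%Z.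
  have -> : 27 * ((B - C) * (B + C)) = 4 * A ^+ 3 + 27 * B ^+ 2 - (4 * A ^+ 3 + 27 * C ^+ 2) by ring.
  exact: rpredB.
rewrite Gauss_dvdzr; last by rewrite (_ : 27 = 3 ^+ 3) // coprimezXl ?coprimezXr.
have [h|h] := boolP (p%:Z %| B - C)%Z; last first.
  by rewrite Gauss_dvdzr ?coprimezXl ?coprimez_prime // => ->; rewrite orbT.
rewrite Gauss_dvdzl; first by move=> ->.
rewrite coprimezXl // coprimez_prime //; apply/negP => h'.
have : (p%:Z %| 2 * B)%Z.
  have -> : 2 * B = (B - C) + (B + C) by ring.
  exact: rpredD.
by rewrite Gauss_dvdzr // (negbTE pB').
Qed.

Section Covers.
Variable R : realType.

Lemma size_flatten_map (I T : Type) (s : seq I) (F : I -> seq T) :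
  (size (flatten [seq F i | i <- s]))%:R = \sum_(i <- s) (size (F i))%:R :> R.
Proof.
elim: s => [|i s IH] /=; first by rewrite big_nil.
by rewrite big_cons size_cat natrD IH.
Qed.

(** Composite values are kept too: the covers only grow, and the inverse squares still sum to at
    most [2 / Q]. *)
Definition moduli (Q : R) (N : nat) := [seq p <- iota 1 N | Q < p%:R].

Lemma mem_moduli (Q : R) N p : (0 < p)%N -> (p <= N)%N -> Q < p%:R -> p \in moduli Q N.
Proof. by move=> p0 pN Qp; rewrite mem_filter Qp mem_iota p0 add1n ltnS. Qed.

Lemma moduli_gt0 (Q : R) N p : p \in moduli Q N -> (0 < p <= N)%N.
Proof. by rewrite mem_filter mem_iota add1n ltnS => /andP[]. Qed.

Lemma sum_moduli (Q : R) N : 0 < Q ->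
  \sum_(p <- moduli Q N) (p%:R ^+ 2)^-1 <= 2 / Q.
Proof. by move=> Q0; rewrite big_filter; exact: sum_inv_sqr_tail. Qed.

Definition divisible_cover (Q : R) (N : nat) : seq (int * int) :=
  flatten [seq [seq (p%:Z * u.1, p%:Z * u.2) | u <- range2 (N %/ p)] | p <- moduli Q N].

(** A nonzero coefficient divisible by [p] has absolute value at least [p], so [p <= N] and [p] is
    among the moduli. *)
Lemma mem_divisible_cover (Q : R) (N p : nat) (A B : int) :
  (0 < p)%N -> Q < p%:R -> (`|A| <= N)%N -> (`|B| <= N)%N -> (p%:Z %| A)%Z -> (p%:Z %| B)%Z ->
  (A != 0) || (B != 0) -> (A, B) \in divisible_cover Q N.
Proof.
move=> p0 Qp hA hB /dvdzP[a aE] /dvdzP[b bE] nz.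
have bound (z c : int) : (`|z| <= N)%N -> z = c * p%:Z -> (`|c| <= N %/ p)%N.
  by move=> zN zE; rewrite leq_divRL //; move: zN; rewrite zE abszM.
apply/flatten_mapP; exists p.
  apply: mem_moduli => //; have le (c : int) : c * p%:Z != 0 -> (p <= `|(c * p%:Z)%R|)%N.
    by rewrite mulf_eq0 negb_or abszM => /andP[c0 _]; rewrite leq_pmull // absz_gt0.
  case/orP: nz => h; [apply: leq_trans hA|apply: leq_trans hB]; rewrite ?aE ?bE; apply: le;
  by rewrite -?aE -?bE.
apply/mapP; exists (a, b); last by rewrite aE bE /= ![p%:Z * _]mulrC.
by apply/allpairsP; exists (a, b); split; rewrite // mem_int_range (bound _ _ _ aE, bound _ _ _ bE).
Qed.

Lemma div_le (N d : nat) : (0 < d)%N -> (N %/ d)%:R <= N%:R / d%:R :> R.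
Proof. by move=> d0; rewrite ler_pdivlMr ?ltr0n // -natrM ler_nat leq_divM. Qed.

Lemma size_divisible_cover (Q : R) (N : nat) : 0 < Q ->
  (size (divisible_cover Q N))%:R <= 18 * N%:R ^+ 2 / Q.
Proof.
move=> Q0; rewrite size_flatten_map.
have -> : 18 * N%:R ^+ 2 / Q = 9 * N%:R ^+ 2 * (2 / Q) by ring.
apply: le_trans (ler_wpM2l _ (sum_moduli N Q0)); last by rewrite mulr_ge0 ?exprn_ge0.
rewrite mulr_sumr big_seq [leRHS]big_seq; apply: ler_sum => p /moduli_gt0/andP[p0 pN].
rewrite size_map size_allpairs !size_int_range.
have -> : 9 * N%:R ^+ 2 / p%:R ^+ 2 = (3 * (N%:R / p%:R)) ^+ 2 :> R.
  by rewrite !exprMn exprVn; ring.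
rewrite natrM -expr2 lerXn2r ?nnegrE ?mulr_ge0 ?divr_ge0 //.
have := div_le N p0.
have : 1 <= N%:R / p%:R :> R by rewrite ler_pdivlMr ?ltr0n // mul1r ler_nat.
by rewrite -natr1 natrM; move: (N%:R / p%:R) (N %/ p)%:R => x y; lra.
Qed.

Definition solutions (N p : nat) (A : int) : seq int :=
  [seq B <- int_range N | (p%:Z ^+ 2 %| 4 * A ^+ 3 + 27 * B ^+ 2)%Z].

(** For each [A] one solution [B0] is fixed; every other one is [B0] or [- B0] plus [j p^2], of
    distance at most [2 N]. The default [0] is reached only when there is no solution. *)
Definition residue_cover (Q : R) (N L : nat) : seq (int * int) :=
  flatten [seq flatten
    [seq [seq (A, e * head 0 (solutions N p A) + j * p%:Z ^+ 2)
         | e <- [:: 1; -1], j <- int_range (2 * N %/ p ^ 2)]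
    | A <- int_range N] | p <- moduli Q L].

Lemma mem_residue_cover (Q : R) (N L p : nat) (A B : int) :
  prime p -> (3 < p)%N -> (p <= L)%N -> Q < p%:R -> (`|A| <= N)%N -> (`|B| <= N)%N ->
  ~~ (p%:Z %| A)%Z -> (p%:Z ^+ 2 %| 4 * A ^+ 3 + 27 * B ^+ 2)%Z ->
  (A, B) \in residue_cover Q N L.
Proof.
move=> pp p3 pL Qp hA hB pA pB.
have tri (x y : int) : (`|x| <= N)%N -> (`|y| <= N)%N ->
    (`|(x - y)%R| <= 2 * N)%N * (`|(x + y)%R| <= 2 * N)%N.
  by clear; split; lia.
apply/flatten_mapP; exists p; first by apply: mem_moduli => //; exact: prime_gt0.
apply/flatten_mapP; exists A; first by rewrite mem_int_range.
set B0 := head 0 _.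
have : B0 \in solutions N p A.
  have : B \in solutions N p A by rewrite mem_filter pB mem_int_range.
  by rewrite /B0; case: (solutions _ _ _) => //= x ? _; rewrite mem_head.
rewrite mem_filter mem_int_range => /andP[pB0 hB0].
have bound (c : int) : (`|(c * p%:Z ^+ 2)%R| <= 2 * N)%N -> c \in int_range (2 * N %/ p ^ 2).
  by rewrite mem_int_range leq_divRL ?expn_gt0 ?prime_gt0 // abszM abszX.
have /orP[/dvdzP[j jE]|/dvdzP[j jE]] := sqr_congruence pp p3 pA pB pB0;
  apply/allpairsP; [exists (1, j)|exists (-1, j)]; split => //=.
- by apply: bound; rewrite -jE (tri _ _ hB hB0).1.
- by rewrite -jE mul1r addrC subrK.
- by apply: bound; rewrite -jE (tri _ _ hB hB0).2.
- by rewrite -jE mulN1r addrC addrK.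
Qed.

(** Each modulus costs [24 N^2 / p^2 + 6 N]; the second term, from rounding, is why the primes
    treated here stop at [L]. *)
Lemma size_residue_cover (Q : R) (N L : nat) : 0 < Q -> (0 < N)%N ->
  (size (residue_cover Q N L))%:R <= 48 * N%:R ^+ 2 / Q + 6 * N%:R * L%:R.
Proof.
move=> Q0 N0; rewrite size_flatten_map.
have N1 : 1 <= N%:R :> R by rewrite ler1n.
apply: (@le_trans _ _ (\sum_(p <- moduli Q L) (24 * N%:R ^+ 2 * (p%:R ^+ 2)^-1 + 6 * N%:R))).
  rewrite big_seq [leRHS]big_seq; apply: ler_sum => p /moduli_gt0/andP[p0 pN].
  rewrite size_flatten_map.
  under eq_bigr do rewrite size_allpairs size_int_range /=.
  rewrite big_const_seq count_predT iter_addr_0 size_int_range -mulrnA.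
  have := @div_le (2 * N) (p ^ 2) ltac:(by rewrite expn_gt0 p0).
  rewrite natrX natrM.
  have -> (k : nat) : ((2 * (2 * k).+1) * (2 * N).+1)%:R
      = 2 * (2 * k%:R + 1) * (2 * N%:R + 1) :> R.
    by rewrite -[((2 * k).+1)%N]addn1 -[((2 * N).+1)%N]addn1 !(natrM, natrD).
  set x := (_ %/ _)%:R; set y := _^-1 => xy.
  have x0 : 0 <= x by [].
  have h1 : 2 * (2 * x + 1) * (2 * N%:R + 1) <= 2 * (2 * x + 1) * (3 * N%:R).
    by rewrite ler_wpM2l //; lra.
  have h2 : x * N%:R <= 2 * N%:R * y * N%:R by rewrite ler_wpM2r.
  apply: le_trans h1 _; rewrite expr2.
  by move: (N%:R : R) y x h2 {x0 xy N1} => n y x h2; lra.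
rewrite big_split /= -mulr_sumr lerD //.
  have -> : 48 * N%:R ^+ 2 / Q = 24 * N%:R ^+ 2 * (2 / Q) by ring.
  by rewrite ler_wpM2l ?sum_moduli // mulr_ge0 ?exprn_ge0.
rewrite big_const_seq count_predT iter_addr_0 -[leLHS]mulr_natr ler_wpM2l ?mulr_ge0 //.
by rewrite ler_nat size_filter (leq_trans (count_size _ _)) // size_iota.
Qed.

Definition root_cover (N S : nat) : seq (int * int) :=
  [seq (A, s ^+ 3 + A * s) | A <- int_range N, s <- int_range S].

(** A root [s != 0] has [|s| |s^2 + A| <= N], hence [s^2 <= 2 N]. *)
Lemma mem_root_cover (N S : nat) (s A B : int) :
  (2 * N < S.+1 ^ 2)%N -> (0 < N)%N -> (`|A| <= N)%N -> (`|B| <= N)%N -> s ^+ 3 + A * s = B ->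
  (A, B) \in root_cover N S.
Proof.
move=> hS N0 hA hB E; apply/allpairsP; exists (A, s); split; rewrite ?mem_int_range //= ?E //.
rewrite -ltnS -ltn_sqr; apply: leq_ltn_trans hS.
have h : s * (s ^+ 2 + A) = B by rewrite -E; ring.
have [->|s0] := eqVneq s 0; first by [].
have : (`|s| * `|(s ^+ 2 + A)%R| <= N)%N by rewrite -abszM h.
have : (`|s| ^ 2 <= `|(s ^+ 2 + A)%R| + N)%N by rewrite -abszX; lia.
have : (0 < `|s|)%N by rewrite absz_gt0.
move=> s1 h1 h2; apply: leq_trans h1 _; rewrite mul2n -addnn leq_add2r.
by apply: leq_trans h2; rewrite leq_pmull.
Qed.

Lemma size_root_cover (N S : nat) : size (root_cover N S) = ((2 * N).+1 * (2 * S).+1)%N.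
Proof. by rewrite size_allpairs !size_int_range. Qed.

(** Inverts the passage from a curve to its tuple; on such tuples the two covariant values are
    [- 3 A] and [27 B], so both divisions are exact. *)
Definition form_pair (u : (int * int) * (int * int)) (v : int * int) : int * int :=
  let: ((a, d), (n, l)) := u in let: (b, c) := v in
  let P := hess0 a b c d in let Q := hess1 a b c d in let S := hess2 a b c d in
  ((qform P Q S l (- n) %/ (- 3))%Z, (jac a b c d P Q S l (- n) %/ 27)%Z).

Definition form_cover (M : nat) (K1 K2 : R) : seq (int * int) :=
  [seq form_pair u v | u <- [seq u <- range4 M | wt4 R u <= K1],
                       v <- [seq v <- range2 M | wt2 R v <= K2]].

Lemma size_form_cover (M : nat) (K1 K2 : R) : 0 <= K1 -> 0 <= K2 ->
  (size (form_cover M K1 K2))%:R <= K1 * K2 * wsum R M ^+ 6.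
Proof.
move=> h1 h2; rewrite size_allpairs natrM.
have -> : K1 * K2 * wsum R M ^+ 6 = (K1 * wsum R M ^+ 4) * (K2 * wsum R M ^+ 2) by ring.
by rewrite ler_pM ?size_wt4 ?size_wt2.
Qed.

Lemma mem_range2 M (u : int * int) (K : R) : wt2 R u <= K -> K <= M%:R -> u \in range2 M.
Proof.
case: u => x y /= /le_trans h /h; rewrite /wt2 /= -natrM ler_nat => le.
apply/allpairsP; exists (x, y); split; rewrite //= mem_int_range (leq_trans (wt_ge _)) //;
  apply: leq_trans le; [exact: leq_pmulr (wt_gt0 _) | exact: leq_pmull (wt_gt0 _)].
Qed.

Lemma mem_range4 M u (K : R) : wt4 R u <= K -> K <= M%:R -> u \in range4 M.
Proof.
case: u => x y /= /le_trans h /h; rewrite /wt4 /= => le.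
have ge1 z : 1 <= wt2 R z by rewrite /wt2 -natrM ler1n muln_gt0 !wt_gt0.
apply/allpairsP; exists (x, y); split=> //=; apply: (mem_range2 (lexx _)); apply: le_trans le.
  by rewrite ler_peMr // ltW ?wt2_gt0.
by rewrite ler_peMl // ltW ?wt2_gt0.
Qed.

End Covers.

(** * Large primes, through reduced cubic forms *)

Section Forms.
Variable R : realType.

Lemma wtE (k : int) : k != 0 -> (wt k)%:R = `|k%:~R| :> R.
Proof. by move=> k0; rewrite /wt (maxn_idPr _) ?absz_gt0 // natr_absz intr_norm. Qed.

Lemma unit_absz (x y : int) : x * y = 1 -> `|y|%N = 1%N.
Proof. by move/(congr1 absz)/eqP; rewrite abszM muln_eq1 => /andP[_ /eqP]. Qed.

Lemma wt0 : wt 0 = 1%N. Proof. by []. Qed.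

(** For [p >= Y >= N^(3/4)] the bounds by [q^3 / p] become bounds by [Y], so the tuples lie in lists
    independent of [p]. *)
Lemma mem_form_cover (M N p : nat) (A B : int) (Y : R) :
  prime p -> (2 < p)%N -> (0 < N)%N -> (`|A| <= N)%N -> (`|B| <= N)%N ->
  ~~ (p%:Z %| A)%Z -> (p%:Z ^+ 2 %| 4 * A ^+ 3 + 27 * B ^+ 2)%Z ->
  (forall s : int, s ^+ 3 + A * s != B) ->
  1 <= Y -> Y <= p%:R -> N%:R ^+ 3 <= Y ^+ 4 -> Y <= 2 * N%:R ->
  144 * N%:R <= M%:R :> R -> 648 * Y <= M%:R ->
  (A, B) \in form_cover M (144 * N%:R) (648 * Y).
Proof.
move=> pp p2 N0 hA hB pA pD root Y1 Yp NY YN MN MY.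
have Y0 : 0 < Y by lra.
have p0 : 0 < p%:R :> R by rewrite ltr0n prime_gt0.
have hA' : `|A| <= N%:Z by rewrite -abszE lez_nat.
have hB' : `|B| <= N%:Z by rewrite -abszE lez_nat.
have [a [b [c [d [n [l /= [[E1 E2] [a0 d0] [m [k D]] bounds]]]]]]] :=
  @reduced_cubic_form R N p A B pp p2 N0 hA' hB' pA pD root.
have N0' : 0 < N%:R :> R by rewrite ltr0n.
pose q : R := Num.sqrt N%:R.
have qN : q ^+ 2 = N%:R by rewrite sqr_sqrtr // ltW.
have q0 : 0 < q by rewrite sqrtr_gt0.
clearbody q; have [] := bounds q q0 qN.
have qY : q ^+ 3 <= Y ^+ 2.
  rewrite -(@ler_pXn2r _ 2) ?nnegrE ?exprn_ge0 ?(ltW q0) ?(ltW Y0) // -!exprM.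
  by rewrite -[(3 * 2)%N]/(2 * 3)%N exprM qN.
have cancel (z K : R) : 0 <= K -> p%:R * z <= K * q ^+ 3 -> z <= K * Y.
  move=> K0 h; have : Y * (K * Y) <= p%:R * (K * Y) by rewrite ler_wpM2r // mulr_ge0 // ltW.
  have : K * q ^+ 3 <= K * Y ^+ 2 by rewrite ler_wpM2l.
  by move=> h1 h2; rewrite -(ler_pM2l p0); lra.
have cancel2 (x : int) (z : R) : 1 <= z -> p%:R ^+ 2 * (z * `|x%:~R| ^+ 3) <= 52 ^+ 3 * q ^+ 6 ->
    `|x%:~R| <= 648 * Y.
  move=> z1 h.
  have x0 : 0 <= `|x%:~R : R| by [].
  have h1 : p%:R ^+ 2 * (z * `|x%:~R| ^+ 3) <= p%:R ^+ 2 * (52 * Y) ^+ 3.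
    apply: le_trans h _.
    have -> : p%:R ^+ 2 * (52 * Y) ^+ 3 = 52 ^+ 3 * (p%:R ^+ 2 * Y ^+ 3) by ring.
    rewrite ler_wpM2l ?exprn_ge0 //.
    have -> : q ^+ 6 = (q ^+ 3) ^+ 2 by rewrite -exprM.
    have h2 : (q ^+ 3) ^+ 2 <= (Y ^+ 2) ^+ 2.
      by rewrite lerXn2r ?nnegrE ?exprn_ge0 ?(ltW q0) ?(ltW Y0).
    have h3 : Y ^+ 2 <= p%:R ^+ 2 by rewrite lerXn2r ?nnegrE ?(ltW Y0) ?(ltW p0).
    apply: le_trans h2 _; rewrite {1}expr2; apply: ler_pM; rewrite ?exprn_ge0 ?(ltW Y0) //.
    by rewrite ler_weXn2l.
  rewrite ler_pM2l ?exprn_gt0 // in h1.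
  have h2 : `|x%:~R| ^+ 3 <= (52 * Y) ^+ 3.
    by apply: le_trans h1; rewrite ler_peMl ?exprn_ge0.
  rewrite ler_pXn2r ?nnegrE ?mulr_ge0 ?(ltW Y0) // in h2; lra.
move=> ad adnl bc ac db.
have one (x : int) : x != 0 -> 1 <= `|x%:~R : R| by rewrite -intr_norm ler1z -gtz0_ge1 normr_gt0.
have -> : (A, B) = form_pair ((a, d), (n, l)) (b, c) by rewrite /= E1 E2 !mulKz.
apply: allpairs_f.
- rewrite mem_filter; suff h : wt4 R ((a, d), (n, l)) <= 144 * N%:R.
    by rewrite h (mem_range4 h MN).
  rewrite /wt4 /wt2 /= !(wtE a0, wtE d0).
  (* If [n] or [l] vanishes, determinant [1] makes the other a unit and both weights are [1]; then
     [72 Y <= 144 N] suffices. *)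
  have unit : n * l = 0 -> (wt n)%:R * (wt l)%:R = 1 :> R.
    rewrite -natrM; move=> /eqP; rewrite mulf_eq0 => /orP[] /eqP z; rewrite z wt0.
      by move: D; rewrite z mul0r subr0 /wt => /unit_absz ->.
    by move: D; rewrite z mulr0 sub0r mulrC -mulNr /wt => /unit_absz ->.
  have [z|] := eqVneq (n * l) 0.
    rewrite (unit z) mulr1; by apply: le_trans (cancel _ 72 _ ad) _ => //; clear -YN; lra.
  by rewrite mulf_eq0 negb_or => /andP[n0 l0]; rewrite !wtE // -qN.
- rewrite mem_filter; suff h : wt2 R (b, c) <= 648 * Y.
    by rewrite h (mem_range2 h MY).
  (* When [b] or [c] is zero, [b c] says nothing about the other entry; the bounds on [a c^3] and
     [d b^3], with [a] and [d] nonzero, replace it. *)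
  rewrite /wt2 /=; have [b0|b0] := eqVneq b 0.
    rewrite b0 wt0 mul1r; have [->|c0] := eqVneq c 0; first by rewrite wt0; clear -Y1; lra.
    by rewrite wtE //; apply: cancel2 (one _ a0) _; exact: ac.
  have [c0|c0] := eqVneq c 0.
    rewrite c0 wt0 mulr1 wtE //.
    by apply: cancel2 (one _ d0) _; exact: db.
  by rewrite !wtE //; exact: (cancel _ 648 (ler0n _ _) bc).
Qed.
End Forms.

(** * Assembly of the four cases and choice of parameters *)

Section Main.
Variable R : realType.

Definition cover (Q : R) (N L S M : nat) (K1 K2 : R) : seq (int * int) :=
  divisible_cover Q N ++ residue_cover Q N L ++ root_cover N S ++ form_cover M K1 K2.

Lemma W_union_cover (Q X Y : R) (N L S M : nat) :
  5 <= Q -> (0 < N)%N -> X < N.+1%:R -> Y < L.+1%:R -> (2 * N < S.+1 ^ 2)%N ->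
  1 <= Y -> N%:R ^+ 3 <= Y ^+ 4 -> Y <= 2 * N%:R ->
  144 * N%:R <= M%:R :> R -> 648 * Y <= M%:R ->
  W_union Q X `<=` [set` cover Q N L S M (144 * N%:R) (648 * Y)].
Proof.
move=> Q5 N0 XN YL hS Y1 NY YN M1 M2 [A B] [p [/= pp Qp] [[[disc0 _] pdisc] ht]].
have p3 : (3 < p)%N.
  by rewrite -(ltr_nat R) (lt_trans _ Qp) // (lt_le_trans _ Q5) // ltr_nat.
have p2 : (2 < p)%N by exact: ltn_trans p3.
have le (z : int) : `|z| <= height (A, B) -> (`|z| <= N)%N.
  move=> hz; rewrite -ltnS -(ltr_nat R) natr_absz.
  by apply: le_lt_trans (lt_trans ht XN); rewrite ler_int.
have hA : (`|A| <= N)%N by apply: le; rewrite /height le_max lexx.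
have hB : (`|B| <= N)%N by apply: le; rewrite /height le_max lexx orbT.
have pD := dvdz_disc pp p2 pdisc.
suff : (A, B) \in cover Q N L S M (144 * N%:R) (648 * Y) by [].
rewrite /cover 3!mem_cat.
have [pA|pA] := boolP (p%:Z %| A)%Z.
  have pB : (p%:Z %| B)%Z by rewrite -(dvdz_coefs pp p3 pD).
  rewrite (mem_divisible_cover (prime_gt0 pp) Qp hA hB pA pB) //.
  apply: contraNT disc0; rewrite negb_or !negbK => /andP[/eqP-> /eqP->].
  by [].
have [pL|pL] := leqP p L.
  by rewrite (mem_residue_cover pp p3 pL Qp hA hB pA pD) !orbT.
have Yp : Y <= p%:R by rewrite (le_trans (ltW YL)) // ler_nat.
have [[s sE]|nroot] := pselect (exists s : int, s ^+ 3 + A * s = B).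
  by rewrite (mem_root_cover hS N0 hA hB sE) !orbT.
rewrite (mem_form_cover pp p2 N0 hA hB pA pD _ Y1 Yp NY YN M1 M2) ?orbT // => s.
by apply/eqP => sE; apply: nroot; exists s.
Qed.

(** [66 = 18 + 48] collects the [1 / Q] terms; [21 = 6 + 15] collects the [X Y] terms of the residue
    and root covers. *)
Lemma size_cover (Q X Y k1 k2 : R) (N L S M : nat) :
  0 < Q -> (0 < N)%N -> 1 <= Y -> 0 <= k1 -> 0 <= k2 ->
  N%:R <= X -> L%:R <= Y -> S%:R <= 2 * Y ->
  (size (cover Q N L S M (k1 * N%:R) (k2 * Y)))%:R <=
    66 * (X ^+ 2 / Q) + X * Y * (21 + k1 * k2 * wsum R M ^+ 6).
Proof.
move=> Q0 N0 Y1 k10 k20 NX LY SY; rewrite /cover 3!size_cat 3!natrD.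
have N1 : 1 <= N%:R :> R by rewrite ler1n.
have Y0 : 0 <= Y by lra.
have a1 := size_divisible_cover N Q0; have a2 := size_residue_cover L Q0 N0.
have -> : (size (root_cover N S))%:R = (2 * N%:R + 1) * (2 * S%:R + 1) :> R.
  by rewrite size_root_cover -[((2 * N).+1)%N]addn1 -[((2 * S).+1)%N]addn1 !(natrM, natrD).
have h1 : N%:R ^+ 2 / Q <= X ^+ 2 / Q.
  by rewrite ler_pM2r ?invr_gt0 // lerXn2r // nnegrE // (le_trans _ NX).
have h2 : N%:R * L%:R <= X * Y by rewrite ler_pM.
have h3 : (2 * N%:R + 1) * (2 * S%:R + 1) <= (3 * X) * (5 * Y).
  by rewrite ler_pM //; lra.
have K1 : 0 <= k1 * N%:R :> R by rewrite mulr_ge0.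
have K2 : 0 <= k2 * Y by rewrite mulr_ge0.
have h4 := size_form_cover M K1 K2.
have h5 : k1 * N%:R * (k2 * Y) * wsum R M ^+ 6 <= X * Y * (k1 * k2 * wsum R M ^+ 6).
  have -> : k1 * N%:R * (k2 * Y) * wsum R M ^+ 6 =
     N%:R * Y * (k1 * k2 * wsum R M ^+ 6) by ring.
  apply: ler_wpM2r; last exact: ler_wpM2r.
  by apply: mulr_ge0; [exact: mulr_ge0 | rewrite exprn_ge0 ?wsum_ge0].
apply: le_trans (lerD a1 (lerD a2 (lerD h3 (le_trans h4 h5)))) _.
set T := k1 * k2 * _.
have -> : 66 * (X ^+ 2 / Q) + X * Y * (21 + T) =
  18 * (X ^+ 2 / Q) + (48 * (X ^+ 2 / Q) + 6 * (X * Y) + (3 * X * (5 * Y) + X * Y * T)) by ring.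
rewrite -[18 * N%:R ^+ 2 / Q]mulrA -[48 * N%:R ^+ 2 / Q]mulrA -[6 * N%:R * L%:R]mulrA.
by apply: lerD; [|apply: lerD => //; apply: lerD]; rewrite ler_wpM2l.
Qed.

End Main.

Theorem theorem1p5 (R : realType) (eps : R) (heps : 0 < eps) :
  exists C : R, 0 < C /\
    forall Q X : R, 5 <= Q -> 0 < X ->
      finite_set (W_union Q X) /\
      (#|` fset_set (W_union Q X)|%fset)%:R
        <= C * (X `^ (2 + eps) / Q + X `^ (7 / 4 + eps)).
Proof.
(* [wsum] enters to the sixth power, once for each of [a], [d], [n], [l], [b], [c]. *)
have e6 : 0 < eps / 6 by rewrite divr_gt0.
have [Cw [Cw0 hw]] := wsum_le e6.
(* With [Y <= 2 N], the range [M = m N] exceeds both [144 N] and [648 Y]. *)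
have [m [m1 m2]] : exists m : nat, 144%:R <= m%:R :> R /\ 648%:R * 2 <= m%:R :> R.
  by exists (648 * 2)%N; split; [rewrite ler_nat | rewrite (natrM R 648 2)].
(* The numerals are kept opaque: unification would expand them in unary. *)
have [k1 [k10 k1E]] : exists k : R, 0 <= k /\ k = 144 by exists 144; split; [exact: ler0n | reflexivity].
have [k2 [k20 k2E]] : exists k : R, 0 <= k /\ k = 648 by exists 648; split; [exact: ler0n | reflexivity].
rewrite -k1E -k2E in m1 m2.
pose D := Cw * m%:R `^ (eps / 6).
have D0 : 0 <= D by rewrite mulr_ge0 ?powR_ge0 // ltW.
pose C := 66 + (21 + k1 * k2 * D ^+ 6).
have D6 : 0 <= k1 * k2 * D ^+ 6 by rewrite mulr_ge0 ?exprn_ge0 // mulr_ge0.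
exists C; split; first by rewrite /C addr_gt0 // ltr_pwDl.
move=> Q X Q5 X0; have Q0 : 0 < Q by lra.
have rhs0 : 0 <= C * (X `^ (2 + eps) / Q + X `^ (7 / 4 + eps)).
  rewrite mulr_ge0 ?addr_ge0 ?divr_ge0 ?powR_ge0 ?(ltW Q0) //.
suff [s sW ss] : exists2 s : seq (int * int), W_union Q X `<=` [set` s] &
    (size s)%:R <= C * (X `^ (2 + eps) / Q + X `^ (7 / 4 + eps)).
  have [fW cW] := card_cover sW; split => //.
  by apply: le_trans ss; rewrite ler_nat.
have [X1|X1] := leP X 1.
  (* Height below [1] forces [A = B = 0], which is singular. *)
  exists [::] => // -[A B] [p _ [[[disc0 _] _] ht]].
  have : height (A, B) < 1 by rewrite -(ltr_int R) (lt_le_trans ht).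
  rewrite /height /= gt_max => /andP[A1 B1].
  have A0 : A = 0 by move: A1; clear; lia.
  have B0 : B = 0 by move: B1; clear; lia.
  by move: disc0; rewrite A0 B0.
(* The threshold [X^(3/4)], written so that [X * Y] is visibly [X^(7/4)]. *)
pose Y := X `^ (7 / 4 - 1).
have X1' := ltW X1.
have Y1 : 1 <= Y by rewrite -[leLHS](powRr0 X) ler_powR //; lra.
have XY : X * Y = X `^ (7 / 4) by rewrite /Y mulr_powRB1 //; lra.
have YX : Y <= X by rewrite -[leRHS]powRr1 ?(ltW X0) // ler_powR //; lra.
have Y4 : Y ^+ 4 = X ^+ 3.
  rewrite -!powR_mulrn ?powR_ge0 ?(ltW X0) // /Y -powRrM; congr (_ `^ _).
  by rewrite /=; lra.
have /andP[NX XN] := truncn_itv (ltW X0).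
have /andP[LY YL] := truncn_itv (le_trans ler01 Y1).
set N := Num.truncn X in NX XN; set L := Num.truncn Y in LY YL.
have N0 : (0 < N)%N by rewrite -ltnS -(ltr_nat R) (le_lt_trans _ XN).
have N1 : 1 <= N%:R :> R by rewrite ler1n.
have YN : Y <= 2 * N%:R by move: XN; rewrite -natr1; lra.
have /andP[SX XS] := truncn_itv (sqrtr_ge0 (2 * N%:R : R)).
set S := Num.truncn _ in SX XS.
(* [S] is about [sqrt (2 N)], and [2 N <= 2 X <= 4 Y^2] because [Y^2 = X^(3/2) >= X]. *)
have SY : S%:R <= 2 * Y.
  apply: le_trans SX _; have -> : 2 * Y = Num.sqrt ((2 * Y) ^+ 2).
    by rewrite sqrtr_sqr ger0_norm // mulr_ge0 ?powR_ge0.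
  rewrite ler_wsqrtr //.
  have : X <= Y ^+ 2.
    rewrite -[leLHS]powRr1 ?(ltW X0) // -powR_mulrn ?powR_ge0 // /Y -powRrM ler_powR //.
    lra.
  lra.
have hS : (2 * N < S.+1 ^ 2)%N.
  rewrite -(ltr_nat R) natrX natrM -[ltLHS]sqr_sqrtr ?mulr_ge0 //.
  by rewrite ltrXn2r // ?sqrtr_ge0.
pose M := (m * N)%N.
have M1 : k1 * N%:R <= M%:R :> R by rewrite natrM ler_wpM2r.
have M2 : k2 * Y <= M%:R.
  rewrite natrM; apply: le_trans (ler_wpM2r (ler0n _ _) m2).
  by rewrite -mulrA ler_wpM2l.
exists (cover Q N L S M (k1 * N%:R) (k2 * Y)).
  rewrite k1E k2E in M1 M2 *; apply: W_union_cover => //; rewrite Y4 lerXn2r ?nnegrE ?(ltW X0) //.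
apply: le_trans (size_cover M Q0 N0 Y1 k10 k20 NX LY SY) _.
have M0 : (0 < M)%N.
  by rewrite muln_gt0 N0 andbT -(ltr_nat R) (lt_le_trans _ m1) // k1E ltr_nat.
have wD : wsum R M ^+ 6 <= D ^+ 6 * X `^ eps.
  have -> : D ^+ 6 * X `^ eps = (D * X `^ (eps / 6)) ^+ 6.
    rewrite [RHS]exprMn -[(X `^ _) ^+ 6]powR_mulrn ?powR_ge0 // -powRrM; congr (_ * _ `^ _).
    by field.
  have w1 : wsum R M <= D * X `^ (eps / 6).
    apply: le_trans (hw _ M0) _; rewrite /D /M natrM powRM // -mulrA.
    rewrite ler_wpM2l ?(ltW Cw0) // ler_wpM2l ?powR_ge0 //.
    by rewrite ge0_ler_powR ?nnegrE ?(ltW e6) ?(ltW X0).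
  apply: lerXn2r w1; rewrite nnegrE ?wsum_ge0 //.
  by rewrite mulr_ge0 ?powR_ge0.
have Xe : 1 <= X `^ eps by rewrite -[leLHS](powRr0 X) ler_powR // ltW.
have -> : X `^ (2 + eps) = X ^+ 2 * X `^ eps.
  by rewrite powRD ?(gt_eqF X0) ?implybT // powR_mulrn // ltW.
have -> : X `^ (7 / 4 + eps) = X * Y * X `^ eps.
  by rewrite powRD ?(gt_eqF X0) ?implybT // XY.
have U0 : 0 <= X ^+ 2 / Q by rewrite divr_ge0 ?exprn_ge0 ?(ltW Q0) ?(ltW X0).
have V0 : 0 <= X * Y by rewrite XY powR_ge0.
rewrite /C [X ^+ 2 * _ / Q]mulrAC.
set U := X ^+ 2 / Q in U0 *; set V := X * Y in V0 *; set Z := X `^ eps in Xe wD *.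
have h1 : U <= U * Z by rewrite ler_peMr.
have h2 : 21 + k1 * k2 * wsum R M ^+ 6 <= (21 + k1 * k2 * D ^+ 6) * Z.
  have -> : (21 + k1 * k2 * D ^+ 6) * Z = 21 * Z + k1 * k2 * (D ^+ 6 * Z) by ring.
  by apply: lerD; [rewrite ler_peMr | rewrite ler_wpM2l // mulr_ge0].
set T := 21 + _ in h2 *; set T' := 21 + _ in h2 *.
have T0 : 0 <= T' by rewrite addr_ge0.
have h3 : V * T <= V * (T' * Z) by rewrite ler_wpM2l.
have h4 : 0 <= V * Z by rewrite mulr_ge0 // (le_trans ler01 Xe).
have h5 : 0 <= T' * (U * Z) by rewrite mulr_ge0 // mulr_ge0 // (le_trans ler01 Xe).
clearbody T T' U V Z; move: h1 h3 h4 h5; clear; lra.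
Qed.
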